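(* Let $f:X\to Y$ be a continuous function from a topological space $X$ onto a topological space $Y$. (1) If $X$ is selectively sequentially pseudocompact, then $Y$ is selectively sequentially pseudocompact. (2) If $X$ is selectively pseudocompact, then $Y$ is selectively pseudocompact.
   Context: All topological spaces are assumed to be Tychonoff (in particular Hausdorff). A topological space $X$ is called selectively sequentially pseudocompact if for every sequence $\{U_n:n\in\mathbb{N}\}$ of non-empty open subsets of $X$ one can choose a point $x_n\in U_n$ for every $n\in\mathbb{N}$ in such a way that the sequence $\{x_n:n\in\mathbb{N}\}$ has a subsequence converging to some point of $X$. A topological space $X$ is called selectively pseudocompact if for each sequence $\{U_n:n\in\mathbb{N}\}$ of non-empty open subsets of $X$ one can choose a point $x\in X$ and a point $x_n\in U_n$ for each $n\in\mathbb{N}$ such that the set $\{n\in\mathbb{N}:x_n\in W\}$ is infinite for every open neighborhood $W$ of $x$. *)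

(* Defs.v *)
From mathcomp Require Import all_boot all_order all_algebra.
From mathcomp Require Import all_classical all_reals all_analysis.

Set Implicit Arguments.
Unset Strict Implicit.
Unset Printing Implicit Defensive.

Local Open Scope classical_set_scope.

(* The separation in [completely_regular_space] is phrased with uniformities;
   by [uniform_separatorP] it amounts to separation of a point from a closed
   set by a continuous function into [0, 1]. *)
Definition tychonoff_space (X : topologicalType) : Prop :=
  hausdorff_space X /\ completely_regular_space X.

Definition selectively_sequentially_pseudocompact (X : topologicalType) : Prop :=
  forall U : nat -> set X,
    (forall n, open (U n)) -> (forall n, U n !=set0) ->
    exists x : nat -> X, (forall n, U n (x n)) /\
      exists (s : nat -> nat) (p : X), increasing_seq s /\ x \o s @ \oo --> p.

Definition selectively_pseudocompact (X : topologicalType) : Prop :=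
  forall U : nat -> set X,
    (forall n, open (U n)) -> (forall n, U n !=set0) ->
    exists (p : X) (x : nat -> X), (forall n, U n (x n)) /\
      forall W : set X, open_nbhs p W -> infinite_set [set n | W (x n)].

(* Main.v *)
Require Import Defs.
From mathcomp Require Import all_boot all_order all_algebra.
From mathcomp Require Import all_classical all_reals all_analysis.

Local Open Scope classical_set_scope.

(** Pull the sets [U n] back along [f]: the preimages are open by continuity and non-empty by
    surjectivity, so the property of [X] selects points [x n] in them. The images [f (x n)] lie in
    [U n], and continuity carries the limit or accumulation point [p] to [f p]. *)

Lemma preimage_surj_nonempty (T S : Type) (f : T -> S) (A : set S) :
  set_surj [set: T] [set: S] f -> A !=set0 -> f @^-1` A !=set0.
Proof.
by move=> sf [y Ay]; have [x _ fxy] := sf y I; exists x; rewrite /preimage/= fxy.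
Qed.

Theorem proposition3p2 (X Y : topologicalType)
    (tychX : tychonoff_space X) (tychY : tychonoff_space Y)
    (f : X -> Y) (cf : continuous f) (sf : set_surj [set: X] [set: Y] f) :
  (selectively_sequentially_pseudocompact X ->
   selectively_sequentially_pseudocompact Y) /\
  (selectively_pseudocompact X -> selectively_pseudocompact Y).
Proof.
have op (A : set Y) : open A -> open (f @^-1` A).
  by move=> oA; apply: open_comp => // x _; exact: cf.
split=> PX U oU U0.
- have [x [Ux [s [p [incr_s xsp]]]]] := PX (fun n => f @^-1` U n)
    (fun n => op _ (oU n)) (fun n => preimage_surj_nonempty _ _ _ _ sf (U0 n)).
  exists (f \o x); split=> //; exists s, (f p); split=> //.
  (* The same subsequence [s] works: continuity at [p] transports its convergence. *)
  by apply: (cvg_comp (x \o s) f xsp); exact: cf.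
- have [p [x [Ux xp]]] := PX (fun n => f @^-1` U n)
    (fun n => op _ (oU n)) (fun n => preimage_surj_nonempty _ _ _ _ sf (U0 n)).
  exists (f p), (f \o x); split=> // W [oW Wfp].
  (* The preimage of [W] is an open neighbourhood of [p], and [x n] lies in it for exactly those [n]
     with [f (x n)] in [W]. *)
  by apply: (xp (f @^-1` W)); split=> //; exact: op.
Qed.
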